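(* Let $n\ge 1$ be an integer and $k$ a field of characteristic not equal to two. Let $S$ be the polynomial ring over $k$ in the $4n$ indeterminates $p_{1i},p_{2i},q_{1i},q_{2i}$ ($1\le i\le n$), and let $Z=S/I$, where $I$ is generated by the quadratic forms $$p_{1i}q_{1j}-p_{2i}q_{2j}\ (1\le i,j\le n),\qquad p_{1i}q_{2i},\ p_{2i}q_{1i}\ (1\le i\le n),$$ $$p_{1i}q_{2j}+p_{1j}q_{2i},\quad p_{2i}q_{1j}+p_{2j}q_{1i}\ (1\le i<j\le n).$$ Then the $k$-algebra $Z$ is not Koszul.
   Context: $Z$ is standard graded with all variables of (total) degree one. A standard graded $k$-algebra $R$ is Koszul if $\operatorname{Tor}^R_i(k,k)_j=0$ for all $i\ge 0$ and all $j\ne i$, where $j$ denotes the internal degree and $k$ is $R$ modulo its homogeneous maximal ideal. *)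

(* Defs.v *)
From HB Require Import structures.
From mathcomp Require Import all_boot all_order all_algebra.
From mathcomp Require Import generic_quotient ring_quotient.
From mathcomp Require Import boolp.
From mathcomp Require Import freeg mpoly.

Set Implicit Arguments.
Unset Strict Implicit.
Unset Printing Implicit Defensive.

Import GRing.Theory.

Local Open Scope ring_scope.
Local Open Scope quotient_scope.

Inductive subgroup_gen (V : zmodType) (G : V -> Prop) : V -> Prop :=
| subgroup_gen0 : subgroup_gen G 0
| subgroup_gen_in x : G x -> subgroup_gen G x
| subgroup_genB x y : subgroup_gen G x -> subgroup_gen G y ->
    subgroup_gen G (x - y).

Inductive ideal_gen (R : comNzRingType) (G : R -> Prop) : R -> Prop :=
| ideal_gen0 : ideal_gen G 0
| ideal_genD a g x : G g -> ideal_gen G x -> ideal_gen G (a * g + x).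

(* V is the direct sum of the subgroups V_ d.                                 *)
Definition is_grading (V : zmodType) (V_ : nat -> V -> Prop) : Prop :=
  [/\ forall d, V_ d 0,
      forall d x y, V_ d x -> V_ d y -> V_ d (x - y),
      forall x, exists N (f : nat -> V),
        (forall d, V_ d (f d)) /\ x = \sum_(d < N) f d
    & forall N (f : nat -> V), (forall d, V_ d (f d)) ->
        \sum_(d < N) f d = 0 -> forall d, (d < N)%N -> f d = 0].

(* The last axiom says that R is generated, as a k-algebra, by finitely many
   elements of degree one.                                                    *)
Record stdGradedAlg (k : fieldType) := StdGradedAlg {
  sga_ring :> comAlgType k;
  sga_comp : nat -> sga_ring -> Prop;
  sga_grading : is_grading sga_comp;
  sga_mul : forall d e x y,
    sga_comp d x -> sga_comp e y -> sga_comp (d + e) (x * y);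
  sga_comp0 : forall x, sga_comp 0 x <-> exists c : k, x = c%:A;
  sga_gen1 : exists m (v : 'I_m -> sga_ring), (forall i, sga_comp 1 (v i)) /\
    forall x, exists p : {mpoly k[m]}, x = mmap (in_alg sga_ring) v p
}.

Record gradedMod (k : fieldType) (R : stdGradedAlg k) := GradedMod {
  gm_mod :> lmodType R;
  gm_comp : nat -> gm_mod -> Prop;
  gm_grading : is_grading gm_comp;
  gm_scale : forall d e (a : R) x,
    sga_comp d a -> gm_comp e x -> gm_comp (d + e) (a *: x)
}.

Definition graded_free (k : fieldType) (R : stdGradedAlg k)
    (F : gradedMod R) : Prop :=
  exists (B : choiceType) (e : B -> F),
  [/\ forall b, exists d, gm_comp d (e b),
      forall x, exists (s : seq B) (c : B -> R), x = \sum_(b <- s) c b *: e b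
    & forall (s : seq B) (c : B -> R), uniq s ->
        \sum_(b <- s) c b *: e b = 0 -> forall b, b \in s -> c b = 0].

Section ResidueField.
Variables (k : fieldType) (R : stdGradedAlg k).

Definition in_max_ideal : R -> Prop :=
  ideal_gen (fun x => exists d, sga_comp d.+1 x).

Definition max_ideal : {pred R} := fun x => `[< in_max_ideal x >].

Lemma ideal_genDD (A : comNzRingType) (G : A -> Prop) a x y :
  ideal_gen G x -> ideal_gen G y -> ideal_gen G (a * x + y).
Proof.
move=> + Gy; elim=> [|b g z Gg _ IH]; first by rewrite mulr0 add0r.
by rewrite mulrDr mulrA -addrA; apply: ideal_genD.
Qed.

Fact max_ideal_zmod_closed : zmod_closed max_ideal.
Proof.
split; first by apply/asboolP; constructor.
move=> x y /asboolP mx /asboolP my; apply/asboolP.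
by rewrite addrC -mulN1r; apply: ideal_genDD.
Qed.

HB.instance Definition _ :=
  GRing.isZmodClosed.Build R max_ideal max_ideal_zmod_closed.

Definition residue : Type := {ideal_quot max_ideal}.

HB.instance Definition _ := GRing.Zmodule.on residue.

Definition residue_scale (a : R) (x : residue) : residue :=
  \pi_({ideal_quot max_ideal}) (a * repr x).

Fact residue_scale_pi (a x : R) :
  residue_scale a (\pi_({ideal_quot max_ideal}) x) = \pi_({ideal_quot max_ideal}) (a * x).
Proof.
apply/eqP; rewrite -Quotient.idealrBE -mulrBr.
have : repr (\pi_({ideal_quot max_ideal}) x) - x \in max_ideal.
  by rewrite Quotient.idealrBE reprK.
move/asboolP=> mx; apply/asboolP; rewrite -[_ * _]addr0.
by apply: ideal_genDD => //; constructor.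
Qed.

Fact residue_surj (x : residue) : exists r : R, x = \pi_({ideal_quot max_ideal}) r.
Proof. by exists (repr (x : {ideal_quot max_ideal})); rewrite reprK. Qed.

Fact residue_scaleA a b x :
  residue_scale a (residue_scale b x) = residue_scale (a * b) x.
Proof. by have [r ->] := residue_surj x; rewrite !residue_scale_pi mulrA. Qed.

Fact residue_scale1 : left_id 1 residue_scale.
Proof. by move=> x; have [r ->] := residue_surj x; rewrite residue_scale_pi mul1r. Qed.

Fact residue_scaleDr : right_distributive residue_scale +%R.
Proof.
move=> a x y; have [r ->] := residue_surj x; have [s ->] := residue_surj y.
by rewrite -(raddfD (\pi_({ideal_quot max_ideal}))) !residue_scale_pi mulrDr raddfD.
Qed.

Fact residue_scaleDl x : {morph residue_scale^~ x : a b / a + b}.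
Proof.
by move=> a b /=; have [r ->] := residue_surj x;
  rewrite !residue_scale_pi mulrDl raddfD.
Qed.

HB.instance Definition _ := GRing.Zmodule_isLmodule.Build R residue
  residue_scaleA residue_scale1 residue_scaleDr residue_scaleDl.

Definition residue_comp (d : nat) (x : residue) : Prop := d = 0%N \/ x = 0.

Fact residue_grading : is_grading residue_comp.
Proof.
split.
- by move=> d; right.
- by move=> [|d] x y; [left | case=> // -> [] // ->; right; rewrite subrr].
- move=> x; exists 1%N, (fun d => if d is 0%N then x else 0).
  by rewrite big_ord1; split=> // -[|d]; [left | right].
- move=> [//|N] f hf; rewrite big_ord_recl big1 ?addr0 => [f0 [|d] // _|i _].
    by case: (hf d.+1).
  by case: (hf (fintype.lift (@ord0 N) i)).
Qed.

Fact residue_comp_scale d e (a : R) x :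
  sga_comp d a -> residue_comp e x -> residue_comp (d + e) (a *: x).
Proof.
move=> ad [->|->]; last by right; rewrite scaler0.
case: d ad => [|d] ad; first by left.
right; have [r ->] := residue_surj x; apply: etrans (residue_scale_pi _ _) _.
apply/eqP; rewrite -(raddf0 (\pi_({ideal_quot max_ideal}))) -Quotient.idealrBE subr0.
apply/asboolP; rewrite mulrC -[_ * _]addr0; apply: ideal_genD; last by constructor.
by exists d.
Qed.

Definition residue_field : gradedMod R :=
  GradedMod residue_grading residue_comp_scale.

End ResidueField.

Section Tensor.
Variables (R : comNzRingType) (M N : lmodType R).

Inductive tensor_rel : {freeg (M * N)} -> Prop :=
| tensor_relDl x x' y :
    tensor_rel (<< (x + x', y) >> - << (x, y) >> - << (x', y) >>)
| tensor_relDr x y y' :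
    tensor_rel (<< (x, y + y') >> - << (x, y) >> - << (x, y') >>)
| tensor_relZ a x y :
    tensor_rel (<< (a *: x, y) >> - << (x, a *: y) >>).

Definition tensor_null : {pred {freeg (M * N)}} :=
  fun z => `[< subgroup_gen tensor_rel z >].

Fact tensor_null_zmod_closed : zmod_closed tensor_null.
Proof.
split; first by apply/asboolP; constructor.
by move=> x y /asboolP ? /asboolP ?; apply/asboolP; constructor.
Qed.

HB.instance Definition _ :=
  GRing.isZmodClosed.Build {freeg (M * N)} tensor_null tensor_null_zmod_closed.

Definition tensor : zmodType := {ideal_quot tensor_null}.

Definition tens (x : M) (y : N) : tensor := \pi_({ideal_quot tensor_null}) << (x, y) >>.

End Tensor.

Record gradedFreeRes (k : fieldType) (R : stdGradedAlg k) (M : gradedMod R) :=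
GradedFreeRes {
  res_mod :> nat -> gradedMod R;
  res_free : forall i, graded_free (res_mod i);
  res_d : forall i, {linear res_mod i.+1 -> res_mod i};
  res_aug : {linear res_mod 0 -> M};
  res_d_deg : forall i d x, gm_comp d x -> gm_comp d (res_d i x);
  res_aug_deg : forall d x, gm_comp d x -> gm_comp d (res_aug x);
  res_exact : forall i x, res_d i x = 0 <-> exists y, x = res_d i.+1 y;
  res_exact0 : forall x, res_aug x = 0 <-> exists y, x = res_d 0 y;
  res_surj : forall z, exists x, z = res_aug x
}.

Section Tor.
Variables (k : fieldType) (R : stdGradedAlg k).

(* A finite sequence of pairs (x, y) stands for the sum of the x (x) y; it is
   homogeneous of degree j if deg x + deg y = j for each pair.                *)
Definition tens_homog (M N : gradedMod R) (j : nat) (s : seq (M * N)) : Prop :=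
  forall p, p \in s ->
    exists a b, [/\ (a + b = j)%N, gm_comp a p.1 & gm_comp b p.2].

Definition tens_sum (M N : gradedMod R) (s : seq (M * N)) : tensor M N :=
  \sum_(p <- s) tens p.1 p.2.

Definition tens_d (M N : gradedMod R) (F : gradedFreeRes M) (i : nat)
    (s : seq (F i.+1 * N)) : tensor (F i) N :=
  \sum_(p <- s) tens (res_d F i p.1) p.2.

Definition tens_cycle (M N : gradedMod R) (F : gradedFreeRes M) (i : nat) :
    seq (F i * N) -> Prop :=
  match i with
  | 0 => fun _ => True
  | i'.+1 => fun s => tens_d s = 0
  end.

(* Tor_i^R(M, N)_j = H_i(F (x) N)_j vanishes, for F a graded free resolution of
   M; by the comparison theorem this does not depend on F. Since everything is
   graded by nat, Tor has no components in negative degrees.                  *)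
Definition Tor_zero (M N : gradedMod R) (i j : nat) : Prop :=
  forall (F : gradedFreeRes M) (s : seq (F i * N)),
    tens_homog j s -> tens_cycle s ->
    exists t : seq (F i.+1 * N), tens_homog j t /\ tens_sum s = tens_d t.

Definition Koszul : Prop :=
  forall i j, j <> i -> Tor_zero (residue_field R) (residue_field R) i j.

End Tor.

Section AlgebraZ.
Variables (k : fieldType) (n : nat).

Local Notation S := {mpoly k[n + n + (n + n)]}.

Definition p1 (i : 'I_n) : S := 'X_(lshift (n + n) (lshift n i)).
Definition p2 (i : 'I_n) : S := 'X_(lshift (n + n) (rshift n i)).
Definition q1 (i : 'I_n) : S := 'X_(rshift (n + n) (lshift n i)).
Definition q2 (i : 'I_n) : S := 'X_(rshift (n + n) (rshift n i)).

Inductive Zrel : S -> Prop :=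
| Zrel_pq i j : Zrel (p1 i * q1 j - p2 i * q2 j)
| Zrel_12 i : Zrel (p1 i * q2 i)
| Zrel_21 i : Zrel (p2 i * q1 i)
| Zrel_sym12 (i j : 'I_n) : (i < j)%N -> Zrel (p1 i * q2 j + p1 j * q2 i)
| Zrel_sym21 (i j : 'I_n) : (i < j)%N -> Zrel (p2 i * q1 j + p2 j * q1 i).

Definition Zideal : {pred S} := fun x => `[< ideal_gen Zrel x >].

Fact Zrel_homog g : Zrel g -> g \is 2.-homog.
Proof.
have XX i j : ('X_i * 'X_j : S) \is 2.-homog.
  by apply: (@dhomogM _ _ _ 1 _ 1); rewrite dhomogX /= mdeg1.
by case=> *; rewrite ?rpredB ?rpredD ?XX.
Qed.

Fact Zideal_closed : idealr_closed Zideal.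
Proof.
split; first by apply/asboolP; constructor.
- apply/asboolP => I1.
  have eval0 x : ideal_gen Zrel x -> x.@[fun=> 0] = 0.
    elim=> [|a g y Gg _ IH]; first by rewrite meval0.
    rewrite mevalD mevalM IH addr0.
    suff -> : g.@[fun=> 0] = 0 by rewrite mulr0.
    by case: Gg => *; rewrite ?(mevalB, mevalD, mevalM, mevalXU, mul0r, subr0, addr0).
  by move/eval0/eqP: I1; rewrite meval1 oner_eq0.
- by move=> a x y /asboolP Ix /asboolP Iy; apply/asboolP/ideal_genDD.
Qed.

HB.instance Definition _ := isIdealr.Build S Zideal Zideal_closed.

Definition Zring : Type := {ideal_quot Zideal}.

HB.instance Definition _ := GRing.ComNzRing.on Zring.

Definition Zpi : S -> Zring := \pi_({ideal_quot Zideal}).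

Fact Zpi_is_zmod_morphism : zmod_morphism Zpi.
Proof. exact: (@raddfB _ _ (\pi_({ideal_quot Zideal}))). Qed.

Fact Zpi_is_monoid_morphism : monoid_morphism Zpi.
Proof.
split; first exact: (@rmorph1 _ _ (\pi_({ideal_quot Zideal}))).
exact: (@rmorphM _ _ (\pi_({ideal_quot Zideal}))).
Qed.

HB.instance Definition _ := GRing.isZmodMorphism.Build S Zring Zpi
  Zpi_is_zmod_morphism.
HB.instance Definition _ := GRing.isMonoidMorphism.Build S Zring Zpi
  Zpi_is_monoid_morphism.

Definition Z_scale (c : k) (x : Zring) : Zring := Zpi c%:MP * x.

Fact Z_scaleA a b x : Z_scale a (Z_scale b x) = Z_scale (a * b) x.
Proof. by rewrite /Z_scale mulrA -rmorphM -mpolyCM. Qed.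

Fact Z_scale1 : left_id 1 Z_scale.
Proof. by move=> x; rewrite /Z_scale mpolyC1 rmorph1 mul1r. Qed.

Fact Z_scaleDr : right_distributive Z_scale +%R.
Proof. by move=> a x y; rewrite /Z_scale mulrDr. Qed.

Fact Z_scaleDl x : {morph Z_scale^~ x : a b / a + b}.
Proof. by move=> a b; rewrite /Z_scale mpolyCD rmorphD mulrDl. Qed.

HB.instance Definition _ := GRing.Zmodule_isLmodule.Build k Zring
  Z_scaleA Z_scale1 Z_scaleDr Z_scaleDl.

Fact Z_scaleAl (a : k) (x y : Zring) : a *: (x * y) = (a *: x) * y.
Proof. exact: mulrA. Qed.

HB.instance Definition _ := GRing.Lmodule_isLalgebra.Build k Zring Z_scaleAl.
HB.instance Definition _ := GRing.Lalgebra_isComAlgebra.Build k Zring.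

Fact Zpi_surj (x : Zring) : exists p, x = Zpi p.
Proof. by exists (repr (x : {ideal_quot Zideal})); rewrite /Zpi reprK. Qed.

Fact ZpiZ c p : Zpi (c *: p) = c *: Zpi p.
Proof. by rewrite -mul_mpolyC rmorphM. Qed.

Fact Zpi_eq0 p : Zpi p = 0 <-> ideal_gen Zrel p.
Proof.
rewrite -(raddf0 Zpi); split=> [/eqP|Ip].
  by rewrite -Quotient.idealrBE subr0 => /asboolP.
by apply/eqP; rewrite -Quotient.idealrBE subr0; apply/asboolP.
Qed.

Fact Zideal_pihomog d x :
  ideal_gen Zrel x -> ideal_gen Zrel (pihomog mdeg d x).
Proof.
elim=> [|a g y Gg _ IH]; first by rewrite raddf0; constructor.
rewrite raddfD /= -[X in X + _]mul1r; apply: ideal_genDD => {IH} //.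
rewrite (pihomog_partitionE (leqnn (mmeasure mdeg a))) mulr_suml raddf_sum /=.
elim/big_ind: _ => [|u v Iu Iv|e _]; first by constructor.
  by rewrite -[u]mul1r; apply: ideal_genDD.
have hag : pihomog mdeg e a * g \is (e + 2).-homog.
  by apply: dhomogM (Zrel_homog Gg); apply: pihomogP.
have [<-|ne] := eqVneq (e + 2)%N d.
  by rewrite pihomog_dE // -[_ * _]addr0; do 2?constructor.
by rewrite (pihomog_ne0 ne hag); constructor.
Qed.

Definition Z_comp (d : nat) (x : Zring) : Prop :=
  exists p : S, p \is d.-homog /\ x = Zpi p.

Fact Z_grading : is_grading Z_comp.
Proof.
split.
- by move=> d; exists 0; rewrite dhomog0 raddf0.
- move=> d x y [p [hp ->]] [q [hq ->]]; exists (p - q).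
  by rewrite rpredB // raddfB.
- move=> x; have [p ->] := Zpi_surj x.
  exists (mmeasure mdeg p), (fun d => Zpi (pihomog mdeg d p)); split.
    by move=> d; exists (pihomog mdeg d p); rewrite pihomogP.
  by rewrite {1}(pihomog_partitionE (leqnn (mmeasure mdeg p))) raddf_sum.
- move=> N f hf; have [g hg] := choice hf.
  under eq_bigr do rewrite (hg _).2.
  rewrite -raddf_sum => /Zpi_eq0 Ig d ltdN; rewrite (hg d).2; apply/Zpi_eq0.
  suff <- : pihomog mdeg d (\sum_(i < N) g i) = g d by apply: Zideal_pihomog.
  rewrite raddf_sum /= (bigD1 (Ordinal ltdN)) //= (pihomog_dE (hg d).1).
  rewrite big1 ?addr0 // => i ne; apply: pihomog_ne0 (hg i).1.
  by apply: contra ne => /eqP eqid; apply/eqP/val_inj.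
Qed.

Fact Z_comp_mul d e x y : Z_comp d x -> Z_comp e y -> Z_comp (d + e) (x * y).
Proof.
move=> [p [hp ->]] [q [hq ->]]; exists (p * q).
by rewrite dhomogM // rmorphM.
Qed.

Fact Z_comp0 x : Z_comp 0 x <-> exists c : k, x = c%:A.
Proof.
have piA c : c%:A = Zpi c%:MP by rewrite -[RHS]mulr1.
split=> [[p [hp ->]]|[c ->]].
  exists p@_0%MM; rewrite piA; congr Zpi; apply/mpolyP=> m; rewrite mcoeffC.
  have [<-|ne0] := eqVneq 0%MM m; first by rewrite mulr1.
  by rewrite mulr0 (dhomog_nemf_coeff hp) //= mdeg_eq0 eq_sym.
exists c%:MP; split; last exact: piA.
by rewrite -[c%:MP]mulr1 mul_mpolyC rpredZ // dhomog1.
Qed.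

Fact Z_gen1 : exists m (v : 'I_m -> Zring), (forall i, Z_comp 1 (v i)) /\
  forall x, exists p : {mpoly k[m]}, x = mmap (in_alg Zring) v p.
Proof.
exists (n + n + (n + n))%N, (fun i => Zpi 'X_i); split=> [i|x].
  by exists 'X_i; rewrite dhomogX /= mdeg1.
have [p ->] := Zpi_surj x; exists p.
rewrite {1}[p]mpolyE raddf_sum /mmap; apply: eq_bigr => m _ /=.
rewrite ZpiZ mulr_algl mpolyXE_id rmorph_prod; congr (_ *: _).
by apply: eq_bigr => i _; rewrite rmorphXn.
Qed.

Definition Zalg : stdGradedAlg k :=
  StdGradedAlg Z_grading Z_comp_mul Z_comp0 Z_gen1.

End AlgebraZ.

(* Main.v *)
From HB Require Import structures.
Require Import Defs.
From mathcomp Require Import all_boot all_order all_algebra.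
From mathcomp Require Import generic_quotient ring_quotient boolp.
From mathcomp Require Import freeg mpoly ring.

(** Let p1, p2, q1, q2 be the variables with a fixed index i, let S be the
    polynomial ring and I the ideal of relations. The quadrics
    g1 = p1 q1 - p2 q2, g2 = p1 q2 and g3 = p2 q1 satisfy
      p1 p2 g1 + p2^2 g2 - p1^2 g3 = 0,
    a syzygy with quadratic coefficients, while I has no syzygy with linear
    coefficients that could produce it. It gives a nonzero class in
    Tor_3(k, k)_4, which the Koszul property forbids.

    The class. In a free resolution F of k, let e be a generator of degree 0 over
    1. The element q_j e is a cycle, covered by some e_j in F_1; then
    p1 e_1 - p2 e_2, p1 e_2 and p2 e_1 are cycles, covered by f_1, f_2, f_3 in
    F_2; and w = p1 p2 f_1 + p2^2 f_2 - p1^2 f_3 is a cycle, covered by some z in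
    F_3, of degree 4. As w has coefficients in the maximal ideal, z tensor 1 is a
    cycle (tens_w_u).

    Its nonvanishing. Write y in I as h1 g1 + h2 g2 + h3 g3 plus multiples of the
    other relations, and consider the coefficient of p1 p2 in h1. It is not a
    function of y, because of the syzygy above, but the difference between its
    value on a y and a(0) times its value on y is one: it only involves
    lower-order coefficients of h1, which can be read off y. This difference is
    the pairing of a and y; it satisfies the cocycle identity pairingM and
    describes an extension of the module I by k. Splicing this extension with the
    start of the resolution gives a class in Ext^3(k, k). Concretely, lift the
    first differentials of F to S; on an element of F_2 that is a cycle, the
    lifted differentials compose to an element of I in two ways, and comparing
    these through the pairing gives a number (cocycle) that does not depend on
    the lifts (cocycle_ideal) and is linear (cocycleZ). So it defines a linear
    form theta on F_3 that kills the boundaries (theta_boundary). Its value at z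
    is the pairing of p1 p2 and g1, which is 2 in our normalization (Phi_W).

    The vanishing of Tor is required for all free resolutions, so one is
    constructed: F_i is free on all pairs of a degree and an element of the
    previous module (free_res). *)

Set Implicit Arguments.
Unset Strict Implicit.
Unset Printing Implicit Defensive.

Import GRing.Theory.

Local Open Scope ring_scope.
Local Open Scope quotient_scope.

(** * Maps out of free modules *)

Lemma zmod_morphismD (U V : zmodType) (f : U -> V) :
  zmod_morphism f -> {morph f : x y / x + y}.
Proof.
move=> fB x y; have f0 : f 0 = 0 by rewrite -(subr0 0) fB subrr.
by rewrite -{1}[y]opprK fB -[- y]sub0r fB f0 sub0r opprK.
Qed.

Section AdditiveExtension.
Variables (G : nzRingType) (B : choiceType) (V : zmodType) (f : B -> G -> V).
Hypothesis fB : forall b, zmod_morphism (f b).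

Definition addlift (z : {freeg B / G}) : V := \sum_(b <- dom z) f b (coeff b z).

Let f0 b : f b 0 = 0. Proof. by rewrite -[X in f b X](subr0 0) fB subrr. Qed.

Lemma addlift_widen (s : seq B) z : uniq s -> {subset dom z <= s} ->
  addlift z = \sum_(b <- s) f b (coeff b z).
Proof.
move=> us sub; rewrite [RHS](bigID (fun b => b \in dom z)) /=.
rewrite [X in _ + X]big1 ?addr0 => [|b nb]; last by rewrite coeff_outdom ?f0.
rewrite -big_filter /addlift; apply: perm_big; apply: uniq_perm.
- exact: uniq_dom.
- exact: filter_uniq.
by move=> b; rewrite mem_filter; case: (boolP (b \in dom z)) => // /sub ->.
Qed.

Lemma addlift_is_zmod_morphism : zmod_morphism addlift.
Proof.
move=> x y; pose s := undup (dom x ++ dom y).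
have us : uniq s by apply: undup_uniq.
rewrite !(addlift_widen us) => [|b|b|b]; rewrite ?mem_undup ?mem_cat.
- by rewrite -sumrB; apply: eq_bigr => b _; rewrite coeffB fB.
- by move=> ->; rewrite orbT.
- by move=> ->.
- by move/domB; rewrite mem_cat.
Qed.

Lemma addliftU c b : addlift << c *g b >> = f b c.
Proof.
rewrite (addlift_widen (s := [:: b])) // ?big_seq1.
  by rewrite coeffU eqxx mulr1.
have [->|c0] := eqVneq c 0; first by rewrite freegU0 dom0.
by rewrite domU.
Qed.

End AdditiveExtension.

Lemma freeg_ext (G : nzRingType) (B : choiceType) (V : zmodType)
    (f g : {freeg B / G} -> V) : zmod_morphism f -> zmod_morphism g ->
  (forall c b, f << c *g b >> = g << c *g b >>) -> f =1 g.
Proof.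
move=> fB gB fg z.
have ext (h : {freeg B / G} -> V) : zmod_morphism h ->
    h z = \sum_(b <- dom z) h << coeff b z *g b >>.
  move=> hB; pose hM := GRing.isZmodMorphism.Build _ _ h hB.
  pose H : {additive {freeg B / G} -> V} := HB.pack h hM.
  by rewrite -{1}(freeg_sumE z) -[h]/(H : _ -> _) (raddf_sum H).
by rewrite (ext f fB) (ext g gB); apply: eq_bigr.
Qed.

Lemma freegZU (G : nzRingType) (B : choiceType) (a c : G) (b : B) :
  a *: << c *g b >> = << (a * c) *g b >> :> {freeg B / G}.
Proof.
by apply/eqP/freeg_eqP => x; rewrite coeffZ !coeffU mulrA.
Qed.

Section LinearExtension.
Variables (G : nzRingType) (B : choiceType) (M : lmodType G) (f : B -> M).

HB.instance Definition _ := GRing.isZmodMorphism.Build {freeg B / G} M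
  (fglift f) (lift_is_additive f).

Lemma fglift_is_scalable : scalable (fglift f).
Proof.
move=> a; apply: freeg_ext => [x y|x y|c b].
- by rewrite scalerBr raddfB.
- by rewrite raddfB scalerBr.
- by rewrite freegZU !liftU scalerA.
Qed.

HB.instance Definition _ := GRing.isScalable.Build G {freeg B / G} M *:%R
  (fglift f) fglift_is_scalable.

End LinearExtension.

(** * Free covers and a free resolution *)

Section Grading.

Lemma sum_ord_widen (V : nmodType) (N N' : nat) (f : nat -> V) : (N <= N')%N ->
  \sum_(d < N) f d = \sum_(d < N') if (d < N)%N then f d else 0.
Proof. by move=> le; rewrite -big_mkcond (big_ord_widen _ f le). Qed.

(** The existence half of a grading only has to be checked on an additive
    generating family: finite decompositions of different lengths add up after
    padding with zeros. *)
Lemma homog_decomp_sum (V : zmodType) (V_ : nat -> V -> Prop) (I : Type)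
    (s : seq I) (x : I -> V) :
  (forall d, V_ d 0) ->
  (forall d x y, V_ d x -> V_ d y -> V_ d (x - y)) ->
  (forall i, exists N (f : nat -> V),
     (forall d, V_ d (f d)) /\ x i = \sum_(d < N) f d) ->
  exists N (f : nat -> V),
    (forall d, V_ d (f d)) /\ \sum_(i <- s) x i = \sum_(d < N) f d.
Proof.
move=> V0 VB dec; elim: s => [|i s [N [f [hf ef]]]].
  by exists 0%N, (fun=> 0); rewrite big_nil big_ord0.
have [N' [g [hg eg]]] := dec i.
have VD d u v : V_ d u -> V_ d v -> V_ d (u + v).
  move=> hu hv; rewrite -[v]opprK; apply: (VB) => //.
  by rewrite -[- v]sub0r; apply: (VB).
exists (maxn N' N), (fun d => (if (d < N')%N then g d else 0) +
                              (if (d < N)%N then f d else 0)); split=> [d|].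
  by apply: (VD); case: ifP.
rewrite big_cons big_split /= ef eg.
by rewrite -!sum_ord_widen // ?leq_maxl ?leq_maxr.
Qed.

Lemma homog_decomp1 (V : zmodType) (V_ : nat -> V -> Prop) d x :
  (forall d, V_ d 0) -> V_ d x ->
  exists N (f : nat -> V), (forall e, V_ e (f e)) /\ x = \sum_(e < N) f e.
Proof.
move=> V0 hx; exists d.+1, (fun e => if e == d then x else 0); split=> [e|].
  by case: eqP => [->|].
rewrite (bigD1 ord_max) //= eqxx big1 ?addr0 // => e.
by rewrite -val_eqE /= => /negPf ->.
Qed.

End Grading.

Section Cover.
Variables (k : fieldType) (R : stdGradedAlg k).

(** Syzygies are kept as predicates on the module that contains them, never as
    subtypes: the next free module is then indexed by plain elements of the
    previous one, and its differential lands there without a coercion. *)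
Record gradedSub := GradedSub {
  gs_mod :> gradedMod R;
  gs_pred : gs_mod -> Prop;
  gs_pred0 : gs_pred 0;
  gs_predZD : forall a x y, gs_pred x -> gs_pred y -> gs_pred (a *: x + y);
  gs_pred_homog : forall N (f : nat -> gs_mod), (forall d, gm_comp d (f d)) ->
    gs_pred (\sum_(d < N) f d) -> forall d, (d < N)%N -> gs_pred (f d)
}.

Lemma sga_comp00 d : sga_comp d (0 : R).
Proof. by case: (sga_grading R). Qed.

Lemma sga_compB d (x y : R) : sga_comp d x -> sga_comp d y -> sga_comp d (x - y).
Proof. by case: (sga_grading R) => _ + _ _; apply. Qed.

Lemma sga_comp1 : sga_comp 0 (1 : R).
Proof. by apply/sga_comp0; exists 1; rewrite scale1r. Qed.

Lemma gm_comp0 (M : gradedMod R) d : gm_comp d (0 : M).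
Proof. by case: (gm_grading M). Qed.

Lemma gm_compB (M : gradedMod R) d (x y : M) :
  gm_comp d x -> gm_comp d y -> gm_comp d (x - y).
Proof. by case: (gm_grading M) => _ + _ _; apply. Qed.

Lemma gm_compD (M : gradedMod R) d (x y : M) :
  gm_comp d x -> gm_comp d y -> gm_comp d (x + y).
Proof.
move=> hx hy; rewrite -[y]opprK; apply: (gm_compB) => //.
by rewrite -[- y]sub0r; apply: gm_compB => //; apply: gm_comp0.
Qed.

Lemma gm_comp_sum (M : gradedMod R) d (I : Type) (s : seq I) (x : I -> M) :
  (forall i, gm_comp d (x i)) -> gm_comp d (\sum_(i <- s) x i).
Proof.
move=> hx; elim/big_rec: _ => [|i y _ hy]; first exact: gm_comp0.
exact: gm_compD.
Qed.

(** The degree j part of the free module R(-e). *)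
Definition shift_comp (e j : nat) (c : R) : Prop :=
  if (e <= j)%N then sga_comp (j - e) c else c = 0.

Lemma shift_comp0 e j : shift_comp e j 0.
Proof. by rewrite /shift_comp; case: ifP => // _; apply: sga_comp00. Qed.

Lemma shift_compB e j c c' :
  shift_comp e j c -> shift_comp e j c' -> shift_comp e j (c - c').
Proof.
rewrite /shift_comp; case: ifP => _; first exact: sga_compB.
by move=> -> ->; rewrite subrr.
Qed.

Section FreeCover.
Variable M : gradedSub.
Local Notation B := (nat * M)%type.
Local Notation F := {freeg B / R}.

Definition cover_comp (j : nat) (z : F) : Prop :=
  forall b : B, shift_comp b.1 j (coeff b z).

Lemma cover_compU (b : B) e c : sga_comp e c -> cover_comp (e + b.1) << c *g b >>.
Proof.
move=> hc b'; rewrite coeffU; case: (eqVneq b b') => [<-|_].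
  by rewrite mulr1 /shift_comp leq_addl addnK.
by rewrite mulr0; apply: shift_comp0.
Qed.

Fact cover_grading : is_grading cover_comp.
Proof.
split.
- by move=> d b; rewrite coeff0; apply: shift_comp0.
- by move=> d x y hx hy b; rewrite coeffB; apply: shift_compB.
- move=> z; rewrite -(freeg_sumE z).
  apply: homog_decomp_sum => [d b|d x y hx hy b|b].
  + by rewrite coeff0; apply: shift_comp0.
  + by rewrite coeffB; apply: shift_compB.
  have [_ _ /(_ (coeff b z)) [N [f [hf ->]]] _] := sga_grading R.
  have -> : << (\sum_(d < N) f d) *g b >> = \sum_(d < N) << f d *g b >> :> F.
    apply/eqP/freeg_eqP => x; rewrite raddf_sum /= coeffU mulr_suml.
    by apply: eq_bigr => d _; rewrite coeffU.
  apply: homog_decomp_sum => [d x|d x y hx hy x'|d].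
  + by rewrite coeff0; apply: shift_comp0.
  + by rewrite coeffB; apply: shift_compB.
  apply: (@homog_decomp1 _ _ (d + b.1)); last exact: cover_compU.
  by move=> e x; rewrite coeff0; apply: shift_comp0.
- move=> N f hf f0 d ltdN; apply/eqP/freeg_eqP => b; rewrite coeff0.
  have [ltdb|lebd] := ltnP d b.1.
    by have := hf d b; rewrite /shift_comp leqNgt ltdb.
  have [_ _ _ uniqR] := sga_grading R.
  have := uniqR (N - b.1)%N (fun j => coeff b (f (j + b.1)%N)).
  rewrite -(subnK lebd); apply; last
    by rewrite ltn_sub2r // (leq_ltn_trans lebd).
    by move=> j; have := hf (j + b.1)%N b; rewrite /shift_comp leq_addl addnK.
  have /(congr1 (coeff b)) := f0; rewrite coeff0 raddf_sum /=.
  have leN : (b.1 <= N)%N by rewrite ltnW // (leq_ltn_trans lebd).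
  rewrite -(big_mkord xpredT (fun i => coeff b (f i))) 
    (big_cat_nat _ (n := b.1)) //=.
  rewrite big_nat big1 ?add0r => [|i /andP[_ lti]]; last first.
    by have := hf i b; rewrite /shift_comp leqNgt lti.
  by rewrite -{1}[b.1]add0n big_addn big_mkord.
Qed.

Fact cover_scale d e (a : R) (z : F) :
  sga_comp d a -> cover_comp e z -> cover_comp (d + e) (a *: z).
Proof.
move=> ha hz b; rewrite coeffZ; have := hz b; rewrite /shift_comp.
have [le|lt] := leqP b.1 e.
  by rewrite (leq_trans le (leq_addl _ _)) -addnBA //; apply: sga_mul.
move=> ->; rewrite mulr0; exact: (shift_comp0 b.1 (d + e)).
Qed.

Definition free_cover : gradedMod R := GradedMod cover_grading cover_scale.

Lemma cover_free : graded_free free_cover.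
Proof.
exists B, (fun b => << b >> : free_cover); split=> [b|z|s c us].
- by exists (0 + b.1)%N; apply: cover_compU; apply: sga_comp1.
- exists (dom (z : F)), (fun b => coeff b (z : F)); rewrite -{1}(freeg_sumE z).
  by apply: eq_bigr => b _; rewrite freegZU mulr1.
move=> s0 b bs; have := congr1 (coeff b) s0; rewrite coeff0 raddf_sum /=.
rewrite (bigD1_seq b) //= coeffZ coeffU eqxx !mulr1 big1 ?addr0 // => b' /negPf ne.
by rewrite coeffZ coeffU ne !mulr0.
Qed.

(** A pair (d, x) for which x is not an element of degree d of the submodule
    still indexes a basis element, of degree d, which is sent to 0. This makes the
    free module larger than necessary but spares a subtype of indices. *)
Definition cover_gen (b : B) : M :=
  if `[< gm_comp b.1 b.2 /\ gs_pred b.2 >] then b.2 else 0.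

Lemma cover_genE d (x : M) : gm_comp d x -> gs_pred x -> cover_gen (d, x) = x.
Proof. by move=> hx px; rewrite /cover_gen asboolT. Qed.

Lemma cover_gen_pred b : gs_pred (cover_gen b).
Proof. by rewrite /cover_gen; case: asboolP => [[]|_] //; apply: gs_pred0. Qed.

Lemma cover_gen_comp b : gm_comp b.1 (cover_gen b).
Proof. by rewrite /cover_gen; case: asboolP => [[]|_] //; apply: gm_comp0. Qed.

Definition cover_map : {linear free_cover -> M} := fglift cover_gen.

Lemma cover_mapU c b : cover_map << c *g b >> = c *: cover_gen b.
Proof. exact: liftU. Qed.

Lemma cover_mapB : zmod_morphism cover_map.
Proof. exact: raddfB. Qed.

Lemma cover_mapD : {morph cover_map : x y / x + y}.
Proof. exact: raddfD. Qed.

Lemma cover_mapE (z : free_cover) :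
  cover_map z = \sum_(b <- dom (z : F)) coeff b (z : F) *: cover_gen b.
Proof.
rewrite -{1}(freeg_sumE z) raddf_sum; apply: eq_bigr => b _.
exact: cover_mapU.
Qed.

Lemma cover_map_deg d (z : free_cover) : gm_comp d z -> gm_comp d (cover_map z).
Proof.
move=> hz; rewrite cover_mapE; apply: gm_comp_sum => b.
have := hz b; rewrite /shift_comp; case: leqP => [le|_ ->]; last first.
  by rewrite scale0r; apply: gm_comp0.
by move=> hc; rewrite -(subnK le); apply: gm_scale => //; apply: cover_gen_comp.
Qed.

(** Surjectivity rests on the submodule being graded: its elements are sums of
    homogeneous elements of it, and each of these is the image of a generator. *)
Lemma cover_map_image x : gs_pred x <-> exists z : free_cover, x = cover_map z.
Proof.
split=> [px|[z ->]]; last first.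
  rewrite cover_mapE; elim/big_rec: _ => [|b y _ py]; first exact: gs_pred0.
  by apply: gs_predZD => //; apply: cover_gen_pred.
have [_ _ /(_ x) [N [f [hf ex]]] _] := gm_grading M.
exists (\sum_(d < N) << (d : nat, f d) >>); rewrite raddf_sum ex.
apply: eq_bigr => d _; rewrite /= liftU scale1r cover_genE //.
by apply: (@gs_pred_homog _ N f hf); rewrite -?ex.
Qed.

End FreeCover.

Definition whole (M : gradedMod R) : gradedSub :=
  @GradedSub M (fun=> True) I (fun _ _ _ _ _ => I) (fun _ _ _ _ _ _ => I).

Section Kernel.
Variable M : gradedSub.

Fact cover_ker0 : cover_map M 0 = 0.
Proof. exact: raddf0. Qed.

Fact cover_kerZD (a : R) (x y : free_cover M) :
  cover_map M x = 0 -> cover_map M y = 0 -> cover_map M (a *: x + y) = 0.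
Proof. by move=> x0 y0; rewrite linearP x0 y0 scaler0 addr0. Qed.

Fact cover_ker_homog N (f : nat -> free_cover M) : (forall d, gm_comp d (f d)) ->
  cover_map M (\sum_(d < N) f d) = 0 ->
  forall d, (d < N)%N -> cover_map M (f d) = 0.
Proof.
move=> hf; rewrite raddf_sum; have [_ _ _] := gm_grading M.
by apply=> d; apply: cover_map_deg.
Qed.

Definition cover_ker : gradedSub :=
  @GradedSub (free_cover M) _ cover_ker0 cover_kerZD cover_ker_homog.

End Kernel.

Section Resolution.
Variable M : gradedMod R.

(** The i-th free module of the resolution is the cover of syzygy i, and
    syzygy i.+1 is a submodule of it. *)
Fixpoint syzygy (i : nat) : gradedSub :=
  if i is i'.+1 then cover_ker (syzygy i') else whole M.

Definition free_res : gradedFreeRes M.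
Proof.
refine (@GradedFreeRes _ _ M (fun i => free_cover (syzygy i))
  (fun i => cover_free _) (fun i => cover_map (syzygy i.+1))
  (cover_map (syzygy 0)) _ _ _ _ _).
- by move=> i d x; apply: cover_map_deg.
- by move=> d x; apply: cover_map_deg.
- by move=> i x; apply: (cover_map_image (M := syzygy i.+2)).
- by move=> x; apply: (cover_map_image (M := syzygy 1)).
- by move=> z; apply/(cover_map_image (M := syzygy 0)).
Defined.

End Resolution.
End Cover.

(** * Tensor products *)

Section TensorBalanced.
Variables (R : comNzRingType) (M N : lmodType R) (V : zmodType).
Variable h : M -> N -> V.
Hypotheses (hDl : forall x x' y, h (x + x') y = h x y + h x' y)
  (hDr : forall x y y', h x (y + y') = h x y + h x y')
  (hZ : forall (a : R) x y, h (a *: x) y = h x (a *: y)).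

Definition balanced_lift : {freeg (M * N)} -> V :=
  addlift (fun (p : M * N) (m : int) => h p.1 p.2 *~ m).

Fact balanced_lift_zmod : zmod_morphism balanced_lift.
Proof. by apply: addlift_is_zmod_morphism => p m m'; rewrite mulrzBr. Qed.

HB.instance Definition _ :=
  GRing.isZmodMorphism.Build {freeg (M * N)} V balanced_lift balanced_lift_zmod.

Lemma balanced_liftU p : balanced_lift << p >> = h p.1 p.2.
Proof. by rewrite /balanced_lift addliftU // => b m m'; rewrite mulrzBr. Qed.

Lemma balanced_lift_null z : subgroup_gen (@tensor_rel R M N) z ->
  balanced_lift z = 0.
Proof.
elim=> [|{}z [x x' y|x y y'|a x y]|x y _ hx _ hy]; first exact: raddf0.
- by rewrite !raddfB /= !balanced_liftU /= hDl addrAC addrK subrr.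
- by rewrite !raddfB /= !balanced_liftU /= hDr addrAC addrK subrr.
- by rewrite raddfB /= !balanced_liftU /= hZ subrr.
- by rewrite raddfB /= hx hy subrr.
Qed.

(** The universal property, in the form in which it separates elements: sums
    that agree in the tensor product agree under every balanced map. *)
Lemma tens_balanced_eq (I J : Type) (s : seq I) (t : seq J) (u : I -> M * N)
    (v : J -> M * N) :
  \sum_(i <- s) tens (u i).1 (u i).2 = \sum_(j <- t) tens (v j).1 (v j).2 ->
  \sum_(i <- s) h (u i).1 (u i).2 = \sum_(j <- t) h (v j).1 (v j).2.
Proof.
have liftE (K : Type) (r : seq K) (w : K -> M * N) :
    balanced_lift (\sum_(i <- r) << ((w i).1, (w i).2) >>) =
    \sum_(i <- r) h (w i).1 (w i).2.
  by rewrite raddf_sum; apply: eq_bigr => i _; apply: balanced_liftU.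
rewrite /tens -!raddf_sum => /eqP; rewrite -Quotient.idealrBE => /asboolP.
move=> null; rewrite -(liftE _ s u) -(liftE _ t v); apply: (@subr0_eq V).
by rewrite -raddfB; apply: balanced_lift_null.
Qed.

End TensorBalanced.

Section TensorRelations.
Variables (R : comNzRingType) (M N : lmodType R).

Lemma tensDl (x x' : M) (y : N) : tens (x + x') y = tens x y + tens x' y.
Proof.
apply/eqP; rewrite -subr_eq0 opprD addrA /tens -!raddfB /=.
rewrite -(raddf0 (\pi_({ideal_quot (@tensor_null R M N)}))) -Quotient.idealrBE.
rewrite subr0.
apply/asboolP/subgroup_gen_in; exact: tensor_relDl.
Qed.

Lemma tensZ a (x : M) (y : N) : tens (a *: x) y = tens x (a *: y).
Proof.
apply/eqP; rewrite /tens -Quotient.idealrBE.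
apply/asboolP/subgroup_gen_in; exact: tensor_relZ.
Qed.

Lemma tensDr (x : M) (y y' : N) : tens x (y + y') = tens x y + tens x y'.
Proof.
apply/eqP; rewrite -subr_eq0 opprD addrA /tens -!raddfB /=.
rewrite -(raddf0 (\pi_({ideal_quot (@tensor_null R M N)}))) -Quotient.idealrBE.
rewrite subr0.
apply/asboolP/subgroup_gen_in; exact: tensor_relDr.
Qed.

Lemma tensr0 (x : M) : tens x (0 : N) = 0.
Proof. by apply: (@addrI _ (tens x 0)); rewrite -tensDr !addr0. Qed.

End TensorRelations.

(** * Change of coefficients and the cocycle on second syzygies *)

Section CoefficientMap.
Variables (S R : comNzRingType) (pi : {rmorphism S -> R}) (B : choiceType).

Definition freeg_map : {freeg B / S} -> {freeg B / R} :=
  addlift (fun b c => << pi c *g b >>).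

Fact freeg_map_gen (b : B) : zmod_morphism (fun c : S => << pi c *g b >>).
Proof. by move=> c c'; rewrite raddfB freegUB. Qed.

Fact freeg_map_zmod : zmod_morphism freeg_map.
Proof. exact: addlift_is_zmod_morphism freeg_map_gen. Qed.
HB.instance Definition _ := GRing.isZmodMorphism.Build {freeg B / S} {freeg B / R}
  freeg_map freeg_map_zmod.

Lemma freeg_mapD : {morph freeg_map : x y / x + y}.
Proof. exact: raddfD. Qed.

Lemma freeg_mapU c b : freeg_map << c *g b >> = << pi c *g b >>.
Proof. exact: (addliftU freeg_map_gen c b). Qed.

Lemma freeg_mapZ a z : freeg_map (a *: z) = pi a *: freeg_map z.
Proof.
move: z; apply: freeg_ext => [x y|x y|c b].
- by rewrite scalerBr raddfB.
- by rewrite raddfB scalerBr.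
by rewrite freegZU !freeg_mapU freegZU rmorphM.
Qed.

Lemma coeff_freeg_map b z : coeff b (freeg_map z) = pi (coeff b z).
Proof.
move: z; apply: freeg_ext => [x y|x y|c b'].
- by rewrite !raddfB.
- by rewrite !raddfB.
by rewrite freeg_mapU !coeffU rmorphM rmorph_nat.
Qed.

Variable sigma : R -> S.
Hypothesis sigmaK : cancel sigma pi.

Definition freeg_lift (u : {freeg B / R}) : {freeg B / S} :=
  \sum_(b <- dom u) << sigma (coeff b u) *g b >>.

Lemma freeg_liftK : cancel freeg_lift freeg_map.
Proof.
move=> u; rewrite raddf_sum -[RHS](freeg_sumE u); apply: eq_bigr => b _.
by rewrite [LHS]freeg_mapU sigmaK.
Qed.

End CoefficientMap.

(** The pairing beta encodes an extension of the kernel of pi by k: on pairs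
    (y, c) with pi y = 0, the action a (y, c) = (a y, eps a c + beta a y) is
    associative by betaM, and an element i of the kernel of pi sends (y, c) to
    (i y, 0). The family xi lifts the generators of the maximal ideal and the
    family rho lifts the first syzygies. *)
Section SyzygyCocycle.
Variables (S R : comNzRingType) (k : comNzRingType).
Variables (pi : {rmorphism S -> R}) (eps : {rmorphism S -> k}).
Variable beta : S -> S -> k.
Hypotheses (betaBl : forall y, zmod_morphism (beta^~ y))
  (betaBr : forall a, zmod_morphism (beta a))
  (beta_ideal : forall i y, pi i = 0 -> beta i y = 0)
  (betaM : forall a b y, pi y = 0 ->
     beta (a * b) y = eps a * beta b y + beta a (b * y)).

Variables (B1 B2 : choiceType) (xi : B1 -> S) (rho : B2 -> {freeg B1 / S}).

Definition syz_eval (U : {freeg B1 / S}) : S := fglift (xi : B1 -> S^o) U.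
Definition syz_diff : {freeg B2 / S} -> {freeg B1 / S} := fglift rho.

HB.instance Definition _ := GRing.Linear.on syz_diff.

Fact syz_eval_zmod : zmod_morphism syz_eval.
Proof. exact: (@raddfB _ _ (fglift (xi : B1 -> S^o))). Qed.
HB.instance Definition _ :=
  GRing.isZmodMorphism.Build {freeg B1 / S} S syz_eval syz_eval_zmod.

Lemma syz_evalZ a U : syz_eval (a *: U) = a * syz_eval U.
Proof. exact: (fglift_is_scalable (xi : B1 -> S^o) a U). Qed.

Lemma syz_evalU c x : syz_eval << c *g x >> = c * xi x.
Proof. exact: (liftU (xi : B1 -> S^o) c x). Qed.

Lemma syz_diffU c r : syz_diff << c *g r >> = c *: rho r.
Proof. exact: liftU. Qed.

Hypotheses (eps_xi : forall x, eps (xi x) = 0)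
  (pi_rho : forall r, pi (syz_eval (rho r)) = 0).

Definition cocycle_l : {freeg B2 / S} -> k :=
  addlift (fun r c => beta c (syz_eval (rho r))).
Definition cocycle_r : {freeg B1 / S} -> k :=
  addlift (fun x c => beta (xi x) c).

Fact cocycle_l_zmod : zmod_morphism cocycle_l.
Proof. by apply: addlift_is_zmod_morphism => r; apply: betaBl. Qed.
Fact cocycle_r_zmod : zmod_morphism cocycle_r.
Proof. by apply: addlift_is_zmod_morphism => r; apply: betaBr. Qed.
HB.instance Definition _ :=
  GRing.isZmodMorphism.Build {freeg B2 / S} k cocycle_l cocycle_l_zmod.
HB.instance Definition _ :=
  GRing.isZmodMorphism.Build {freeg B1 / S} k cocycle_r cocycle_r_zmod.

Lemma cocycle_lU c r : cocycle_l << c *g r >> = beta c (syz_eval (rho r)).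
Proof. by apply: addliftU => b; apply: betaBl. Qed.
Lemma cocycle_rU c x : cocycle_r << c *g x >> = beta (xi x) c.
Proof. by apply: addliftU => b; apply: betaBr. Qed.

(** The two terms have the same failure of linearity when the differential of z
    vanishes modulo the kernel of pi, so that their difference is linear there. *)
Definition cocycle (z : {freeg B2 / S}) : k :=
  cocycle_l z - cocycle_r (syz_diff z).

Fact cocycle_zmod : zmod_morphism cocycle.
Proof.
move=> x y; rewrite /cocycle cocycle_l_zmod (raddfB syz_diff) cocycle_r_zmod.
by ring.
Qed.
HB.instance Definition _ :=
  GRing.isZmodMorphism.Build {freeg B2 / S} k cocycle cocycle_zmod.

Lemma cocycle_lZ a z :
  cocycle_l (a *: z) = eps a * cocycle_l z + beta a (syz_eval (syz_diff z)).
Proof.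
move: z; apply: freeg_ext => [x y|x y|c r].
- by rewrite scalerBr raddfB.
- by rewrite !raddfB /= betaBr; ring.
by rewrite freegZU !cocycle_lU syz_diffU syz_evalZ betaM.
Qed.

Lemma cocycle_rZ a U : (forall x, pi (coeff x U) = 0) ->
  cocycle_r (a *: U) = eps a * cocycle_r U + beta a (syz_eval U).
Proof.
move=> U0; pose hM := GRing.isZmodMorphism.Build _ _ _ (betaBr a).
pose H : {additive S -> k} := HB.pack (beta a) hM.
rewrite -(freeg_sumE U) scaler_sumr !raddf_sum mulr_sumr.
rewrite -[beta a]/(H : S -> k) (raddf_sum H) -big_split.
apply: eq_bigr => x _; rewrite [LHS]/= freegZU /= syz_evalU !cocycle_rU.
have cocycleC : beta (xi x) (a * coeff x U) = beta (a * xi x) (coeff x U).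
  by rewrite [a * xi x]mulrC betaM // eps_xi mul0r add0r.
by rewrite cocycleC betaM // [xi x * _]mulrC.
Qed.

Lemma cocycle_r_ideal i U : pi i = 0 -> cocycle_r (i *: U) = beta (syz_eval U) i.
Proof.
move=> i0; move: U; apply: freeg_ext => [x y|x y|c x].
- by rewrite scalerBr raddfB.
- by rewrite raddfB betaBl.
rewrite freegZU cocycle_rU syz_evalU [c * _]mulrC betaM // eps_xi mul0r add0r.
by rewrite mulrC.
Qed.

(** The two terms cancel the choice of lifts: for i in the kernel of pi, both
    beta i y and beta y i vanish when pi y = 0, and the latter is all that the
    second term contributes. *)
Lemma cocycle_ideal z : (forall r, pi (coeff r z) = 0) -> cocycle z = 0.
Proof.
move=> z0; rewrite -(freeg_sumE z) raddf_sum big1 // => r _ /=.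
by rewrite /cocycle cocycle_lU syz_diffU cocycle_r_ideal // !beta_ideal ?subrr.
Qed.

Lemma cocycleZ a z : (forall x, pi (coeff x (syz_diff z)) = 0) ->
  cocycle (a *: z) = eps a * cocycle z.
Proof.
by move=> z0; rewrite /cocycle cocycle_lZ linearZ /= cocycle_rZ //; ring.
Qed.

End SyzygyCocycle.

(** * The residue field *)

Section ResidueMap.
Variables (k : fieldType) (R : stdGradedAlg k).

Definition residue_pi (r : R) : residue R := \pi_({ideal_quot (@max_ideal k R)}) r.

Fact residue_pi_zmod : zmod_morphism residue_pi.
Proof. exact: (@raddfB _ _ (\pi_({ideal_quot (@max_ideal k R)}))). Qed.
HB.instance Definition _ := GRing.isZmodMorphism.Build R (residue R) residue_pi
  residue_pi_zmod.

Definition residue_repr (x : residue R) : R :=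
  repr (x : {ideal_quot (@max_ideal k R)}).

Lemma residue_reprK : cancel residue_repr residue_pi.
Proof. by move=> x; apply: reprK. Qed.

Lemma residue_piZ a r : residue_pi (a * r) = a *: residue_pi r.
Proof. exact: (esym (residue_scale_pi a r)). Qed.

Lemma residue_pi_eq0 r : residue_pi r = 0 <-> in_max_ideal r.
Proof.
rewrite -(raddf0 residue_pi); split=> [/eqP|mr].
  by rewrite -Quotient.idealrBE subr0 => /asboolP.
by apply/eqP; rewrite -Quotient.idealrBE subr0; apply/asboolP.
Qed.

Lemma in_max_ideal_comp d (r : R) : sga_comp d.+1 r -> in_max_ideal r.
Proof.
move=> hr; rewrite -[r]mul1r -[_ * _]addr0; apply: ideal_genD; last by constructor.
by exists d.
Qed.

End ResidueMap.

(** * A class in the third Tor of the residue field, of degree four *)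

Section Obstruction.
Variables (k : fieldType) (R : stdGradedAlg k) (S : comNzRingType).
Variables (pi : {rmorphism S -> R}) (eps : {rmorphism S -> k}).
Variable sigma : R -> S.
Hypothesis sigmaK : cancel sigma pi.
Hypothesis eps_max : forall s, in_max_ideal (pi s) -> eps s = 0.
Variable beta : S -> S -> k.
Hypotheses (betaBl : forall y, zmod_morphism (beta^~ y))
  (betaBr : forall a, zmod_morphism (beta a))
  (beta_ideal : forall i y, pi i = 0 -> beta i y = 0)
  (betaM : forall a b y, pi y = 0 ->
     beta (a * b) y = eps a * beta b y + beta a (b * y)).

Local Notation M := (residue_field R).
Local Notation K i := (syzygy M i).

Lemma eps_ker s : pi s = 0 -> eps s = 0.
Proof. by move=> s0; apply: eps_max; rewrite s0; constructor. Qed.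

Definition aug (r : R) : k := eps (sigma r).

Lemma aug_pi s : aug (pi s) = eps s.
Proof.
by apply: subr0_eq; rewrite -raddfB; apply: eps_ker; rewrite raddfB /= sigmaK subrr.
Qed.

Fact aug_zmod : zmod_morphism aug.
Proof. by move=> r r'; rewrite -(sigmaK r) -(sigmaK r') -raddfB !aug_pi raddfB. Qed.
HB.instance Definition _ := GRing.isZmodMorphism.Build R k aug aug_zmod.

Lemma augM r r' : aug (r * r') = aug r * aug r'.
Proof. by rewrite -{1}(sigmaK r) -{1}(sigmaK r') -rmorphM aug_pi rmorphM. Qed.

Lemma aug_max r : in_max_ideal r -> aug r = 0.
Proof. by move=> mr; apply: eps_max; rewrite sigmaK. Qed.

(** The comparison map from the free cover of the residue field to the ring; it
    is the start of a lift of the resolution to S. *)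
Definition base_lift : {linear free_cover (K 0) -> R^o} :=
  fglift (fun b => residue_repr (cover_gen (M := K 0) b : residue R) : R^o).

Lemma base_liftU c b :
  base_lift << c *g b >> = c * residue_repr (cover_gen (M := K 0) b : residue R).
Proof. exact: liftU. Qed.

Lemma base_lift_pi z : residue_pi (base_lift z) = cover_map (K 0) z.
Proof.
move: z; apply: freeg_ext => [x y|x y|c b].
- by rewrite !raddfB.
- by rewrite raddfB.
by rewrite base_liftU residue_piZ residue_reprK cover_mapU.
Qed.

Definition var_lift (b : nat * free_cover (K 0)) : S :=
  sigma (base_lift (cover_gen (M := K 1) b)).

Lemma eps_var_lift b : eps (var_lift b) = 0.
Proof.
apply: eps_max; rewrite sigmaK; apply/residue_pi_eq0.
by rewrite base_lift_pi; apply: (cover_gen_pred (M := K 1)).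
Qed.

Definition rel_lift (b : nat * free_cover (K 1)) :
    {freeg (nat * free_cover (K 0)) / S} :=
  freeg_lift sigma (cover_gen (M := K 2) b).

Lemma pi_syz_eval U :
  pi (syz_eval var_lift U) = base_lift (cover_map (K 1) (freeg_map pi U)).
Proof.
move: U; apply: freeg_ext => [x y|x y|c b].
- by rewrite !raddfB.
- by rewrite !raddfB.
by rewrite syz_evalU freeg_mapU cover_mapU linearZ /= rmorphM sigmaK.
Qed.

Lemma pi_rel_lift b : pi (syz_eval var_lift (rel_lift b)) = 0.
Proof.
rewrite pi_syz_eval freeg_liftK // (cover_gen_pred (M := K 2)).
exact: raddf0.
Qed.

Lemma freeg_map_syz_diff z :
  freeg_map pi (syz_diff rel_lift z) = cover_map (K 2) (freeg_map pi z).
Proof.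
move: z; apply: freeg_ext => [x y|x y|c b].
- by rewrite !raddfB.
- by rewrite !raddfB.
by rewrite syz_diffU freeg_mapZ freeg_liftK // freeg_mapU cover_mapU.
Qed.

Local Notation Phi := (cocycle beta var_lift rel_lift).

Lemma Phi_ideal z : freeg_map pi z = 0 -> Phi z = 0.
Proof.
move=> z0; apply: (cocycle_ideal (pi := pi) (eps := eps)) => //.
- exact: eps_var_lift.
- exact: pi_rel_lift.
- by move=> r; rewrite -coeff_freeg_map z0 coeff0.
Qed.

Lemma PhiZ a z : cover_map (K 2) (freeg_map pi z) = 0 ->
  Phi (a *: z) = eps a * Phi z.
Proof.
move=> z0; apply: (cocycleZ (pi := pi)) => //.
- exact: eps_var_lift.
- exact: pi_rel_lift.
by move=> x; rewrite -coeff_freeg_map freeg_map_syz_diff z0 coeff0.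
Qed.

Definition syz_lift (b : nat * free_cover (K 2)) :
    {freeg (nat * free_cover (K 1)) / S} :=
  freeg_lift sigma (cover_gen (M := K 3) b).

(** The cocycle as a linear form on the third free module. A basis element of
    that module is a second syzygy, on which Phi is linear up to eps. *)
Definition theta : free_cover (K 3) -> k :=
  addlift (fun b c => aug c * Phi (syz_lift b)).

Fact theta_gen b : zmod_morphism (fun c => aug c * Phi (syz_lift b)).
Proof. by move=> c c'; rewrite raddfB mulrBl. Qed.

Fact theta_zmod : zmod_morphism theta.
Proof. exact: addlift_is_zmod_morphism theta_gen. Qed.
HB.instance Definition _ := GRing.isZmodMorphism.Build (free_cover (K 3)) k
  theta theta_zmod.

Lemma thetaU c b : theta << c *g b >> = aug c * Phi (syz_lift b).
Proof. exact: (addliftU theta_gen c b). Qed.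

Lemma thetaZ a z : theta (a *: z) = aug a * theta z.
Proof.
move: z; apply: freeg_ext => [x y|x y|c b].
- by rewrite scalerBr raddfB.
- by rewrite raddfB mulrBr.
by rewrite freegZU !thetaU augM mulrA.
Qed.

(** The form theta comes from Phi on the second syzygies, hence it cannot see
    the next syzygies: lifted to S, a relation between second syzygies becomes an
    element with coefficients in the kernel of pi, where Phi vanishes. *)
Lemma theta_boundary x : cover_map (K 3) x = 0 -> theta x = 0.
Proof.
have thetaE (X : {freeg (nat * free_cover (K 2)) / S}) :
    theta (freeg_map pi X) = Phi (fglift syz_lift X).
  move: X; apply: freeg_ext => [X Y|X Y|c b].
  - by rewrite !raddfB.
  - by rewrite raddfB cocycle_zmod.
  rewrite freeg_mapU thetaU aug_pi liftU PhiZ // freeg_liftK //.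
  exact: (cover_gen_pred (M := K 3)).
have mapE (X : {freeg (nat * free_cover (K 2)) / S}) :
    freeg_map pi (fglift syz_lift X) = cover_map (K 3) (freeg_map pi X).
  move: X; apply: freeg_ext => [X Y|X Y|c b].
  - by rewrite !raddfB.
  - by rewrite !raddfB.
  by rewrite liftU freeg_mapZ freeg_liftK // freeg_mapU cover_mapU.
move=> x0; rewrite -[x](freeg_liftK sigmaK) thetaE; apply: Phi_ideal.
by rewrite mapE freeg_liftK.
Qed.

Variables a1 a2 b1 b2 : S.
Hypotheses (a1_deg : sga_comp 1 (pi a1)) (a2_deg : sga_comp 1 (pi a2))
  (b1_deg : sga_comp 1 (pi b1)) (b2_deg : sga_comp 1 (pi b2)).
Hypotheses (rel1 : pi (a1 * b1 - a2 * b2) = 0) (rel2 : pi (a1 * b2) = 0)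
  (rel3 : pi (a2 * b1) = 0).
Hypotheses (beta11 : forall y, beta (a1 * a1) y = 0)
  (beta22 : forall y, beta (a2 * a2) y = 0)
  (beta12 : forall x y, pi y = 0 ->
     beta (a1 * a2) (x * y) = eps x * beta (a1 * a2) y)
  (beta_neq0 : beta (a1 * a2) (a1 * b1 - a2 * b2) != 0).

Let u : residue R := residue_pi 1.
Let x1 : free_cover (K 0) := << pi b1 *g (0%N, u : K 0) >>.
Let x2 : free_cover (K 0) := << pi b2 *g (0%N, u : K 0) >>.
Let E1 : {freeg (nat * free_cover (K 0)) / S} :=
  << a1 *g (1%N, x1) >> - << a2 *g (1%N, x2) >>.
Let E2 : {freeg (nat * free_cover (K 0)) / S} := << a1 *g (1%N, x2) >>.
Let E3 : {freeg (nat * free_cover (K 0)) / S} := << a2 *g (1%N, x1) >>.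
Let f1 : nat * free_cover (K 1) := (2%N, freeg_map pi E1).
Let f2 : nat * free_cover (K 1) := (2%N, freeg_map pi E2).
Let f3 : nat * free_cover (K 1) := (2%N, freeg_map pi E3).
Let W : {freeg (nat * free_cover (K 1)) / S} :=
  << (a1 * a2) *g f1 >> + << (a2 * a2) *g f2 >> - << (a1 * a1) *g f3 >>.
Let w : free_cover (K 2) := freeg_map pi W.

Lemma eps_a : eps a1 = 0 /\ eps a2 = 0.
Proof. by split; apply: eps_max; apply: (@in_max_ideal_comp _ _ 0). Qed.

Lemma deg1_u (b : S) : sga_comp 1 (pi b) -> pi b *: u = 0.
Proof.
move=> hb; rewrite -residue_piZ mulr1; apply/residue_pi_eq0.
exact: (@in_max_ideal_comp _ _ 0).
Qed.

Lemma gen_u : cover_gen (M := K 0) (0%N, u) = u.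
Proof. exact: (@cover_genE k R (K 0) 0%N u (or_introl erefl) I). Qed.

Lemma gen_x (b : S) : sga_comp 1 (pi b) ->
  let x : free_cover (K 0) := << pi b *g (0%N, u : K 0) >> in
  cover_gen (M := K 1) (1%N, x) = x.
Proof.
move=> hb /=; apply: (@cover_genE k R (K 1) 1%N).
  exact: (@cover_compU _ _ (K 0) (0%N, u) 1).
by apply: etrans (@cover_mapU k R (K 0) _ _) _; rewrite gen_u deg1_u.
Qed.

Lemma gen_f (E : {freeg (nat * free_cover (K 0)) / S}) :
  gm_comp 2 (freeg_map pi E : free_cover (K 1)) ->
  cover_map (K 1) (freeg_map pi E) = 0 ->
  cover_gen (M := K 2) (2%N, freeg_map pi E) = freeg_map pi E.
Proof. exact: (@cover_genE k R (K 2) 2%N). Qed.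

Lemma gen_f1 : cover_gen (M := K 2) f1 = freeg_map pi E1.
Proof.
apply: gen_f; rewrite /E1 freeg_map_zmod !freeg_mapU.
  by apply: gm_compB; apply: (@cover_compU _ _ (K 1) (1%N, _) 1).
rewrite cover_mapB !cover_mapU !gen_x // !freegZU -!rmorphM freegUB -raddfB.
by rewrite [LHS]/= rel1 freegU0.
Qed.

Lemma gen_f2 : cover_gen (M := K 2) f2 = freeg_map pi E2.
Proof.
apply: gen_f; rewrite /E2 freeg_mapU.
  exact: (@cover_compU _ _ (K 1) (1%N, _) 1).
by rewrite cover_mapU gen_x // freegZU -rmorphM rel2 freegU0.
Qed.

Lemma gen_f3 : cover_gen (M := K 2) f3 = freeg_map pi E3.
Proof.
apply: gen_f; rewrite /E3 freeg_mapU.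
  exact: (@cover_compU _ _ (K 1) (1%N, _) 1).
by rewrite cover_mapU gen_x // freegZU -rmorphM rel3 freegU0.
Qed.

Lemma mapW : w = << pi (a1 * a2) *g f1 >> + << pi (a2 * a2) *g f2 >> -
  << pi (a1 * a1) *g f3 >>.
Proof. by rewrite /w freeg_map_zmod freeg_mapD !freeg_mapU. Qed.

(** The syzygy with quadratic coefficients between the three relations. It holds
    for the lifts E1, E2, E3 over S, so w is a second syzygy. *)
Lemma exact_relation :
  (a1 * a2) *: E1 + (a2 * a2) *: E2 - (a1 * a1) *: E3 = 0.
Proof.
apply/eqP/freeg_eqP => x; rewrite !(coeffB, coeffD, coeffZ, coeffU) coeff0; ring.
Qed.

Lemma map_w : cover_map (K 2) w = 0.
Proof.
rewrite mapW cover_mapB cover_mapD !cover_mapU gen_f1 gen_f2 gen_f3.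
by rewrite -!freeg_mapZ -freeg_mapD -freeg_map_zmod exact_relation raddf0.
Qed.

(** The chosen lifts of the first syzygies differ from E1, E2, E3 by elements
    with coefficients in the kernel of pi. The exact relation removes E1, E2, E3
    from the second term of the cocycle; what remains is the value of beta at
    (a1 a2, a1 b1 - a2 b2), as the lift c of 1 satisfies eps c = 1. *)
Lemma Phi_W : Phi W != 0.
Proof.
pose r (b : nat * free_cover (K 1)) E := rel_lift b - E.
have diffW : syz_diff rel_lift W = (a1 * a2) *: r f1 E1 + (a2 * a2) *: r f2 E2 -
    (a1 * a1) *: r f3 E3.
  rewrite /W !(raddfB, raddfD) /= !syz_diffU /r.
  rewrite -[LHS]subr0 -exact_relation.
  apply/eqP/freeg_eqP => x; rewrite !(coeffB, coeffD, coeffN, coeffZ); ring.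
have r_ideal b E : cover_gen (M := K 2) b = freeg_map pi E ->
    forall x, pi (coeff x (r b E)) = 0.
  move=> gen x; rewrite -coeff_freeg_map freeg_map_zmod freeg_liftK // gen.
  by rewrite subrr coeff0.
have [ea1 ea2] := eps_a.
have rZ a b E : eps a = 0 -> cover_gen (M := K 2) b = freeg_map pi E ->
    cocycle_r beta var_lift (a *: r b E) = beta a (syz_eval var_lift (r b E)).
  move=> a0 gen; rewrite (cocycle_rZ (pi := pi) (eps := eps)) //.
  + by rewrite a0 mul0r add0r.
  + exact: eps_var_lift.
  exact: r_ideal.
have evalB := syz_eval_zmod var_lift.
rewrite /cocycle diffW /W.
have lB := cocycle_l_zmod betaBl var_lift rel_lift.
have rB := cocycle_r_zmod betaBr var_lift.
rewrite lB (zmod_morphismD lB) rB (zmod_morphismD rB) !cocycle_lU //.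
rewrite !rZ ?gen_f1 ?gen_f2 ?gen_f3 ?rmorphM ?ea1 ?ea2 ?mul0r //.
rewrite !beta11 !beta22 !addr0 !subr0 -betaBr -evalB opprB addrC subrK.
rewrite /E1 evalB !syz_evalU.
pose c := sigma (residue_repr u).
have eps_c : eps c = 1.
  apply: subr0_eq; rewrite -(rmorph1 eps) -raddfB; apply: eps_max.
  apply/residue_pi_eq0.
  by rewrite raddfB raddfB /= sigmaK residue_reprK rmorph1 subrr.
have lift_var (b : S) : sga_comp 1 (pi b) ->
    pi (var_lift (1%N, << pi b *g (0%N, u : K 0) >>) - b * c) = 0.
  move=> hb; rewrite /var_lift gen_x // base_liftU gen_u.
  by rewrite raddfB /= rmorphM !sigmaK subrr.
set v1 := var_lift _; set v2 := var_lift _.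
have -> : a1 * v1 - a2 * v2 =
    a1 * (v1 - b1 * c) - a2 * (v2 - b2 * c) + c * (a1 * b1 - a2 * b2) by ring.
rewrite (zmod_morphismD (betaBr _)) betaBr !beta12 ?lift_var //.
by rewrite ea1 ea2 eps_c !mul0r subr0 add0r mul1r.
Qed.

Let z : free_cover (K 3) := << (4%N, w) >>.

Lemma w_deg : gm_comp 4 w.
Proof.
have degF (E : free_cover (K 1)) (a b : S) :
    sga_comp 1 (pi a) -> sga_comp 1 (pi b) ->
    gm_comp 4 (<< pi (a * b) *g (2%N, E) >> : free_cover (K 2)).
  move=> ha hb; rewrite rmorphM; apply: (@cover_compU _ _ (K 2) (2%N, _) 2).
  exact: (sga_mul ha hb).
by rewrite mapW; apply: gm_compB; [apply: gm_compD|]; apply: degF.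
Qed.

Lemma gen_w : cover_gen (M := K 3) (4%N, w) = w.
Proof. exact: (@cover_genE k R (K 3) 4%N w w_deg map_w). Qed.

Lemma theta_z : theta z != 0.
Proof.
rewrite thetaU -(rmorph1 pi) aug_pi rmorph1 mul1r.
suff -> : Phi (syz_lift (4%N, w)) = Phi W by apply: Phi_W.
apply: subr0_eq; rewrite -cocycle_zmod //; apply: Phi_ideal.
by rewrite freeg_map_zmod freeg_liftK // gen_w subrr.
Qed.

(** All coefficients of w lie in the maximal ideal. *)
Lemma tens_w_u : tens w u = 0.
Proof.
have tensF (E : free_cover (K 1)) (a b : S) : sga_comp 1 (pi b) ->
    tens (<< pi (a * b) *g (2%N, E) >> : free_cover (K 2)) u = 0.
  move=> hb; rewrite -[pi _]mulr1 -freegZU tensZ rmorphM -scalerA deg1_u //.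
  by rewrite scaler0 tensr0.
have -> : w = << pi (a1 * a2) *g f1 >> + << pi (a2 * a2) *g f2 >> +
    << pi (a1 * - a1) *g f3 >>.
  by rewrite mapW mulrN rmorphN -freegUN.
rewrite !tensDl !tensF ?addr0 // raddfN -sub0r.
by apply: sga_compB => //; apply: sga_comp00.
Qed.

Lemma map_z : cover_map (K 3) z = w.
Proof. by rewrite /z cover_mapU scale1r gen_w. Qed.

(** The class of z tensor 1 is a cycle because w has coefficients in the maximal
    ideal, and theta tensor the identity shows that it is not a boundary. *)
Theorem obstruction_not_Koszul : ~ Koszul R.
Proof.
have neq34 : 4%N <> 3%N by [].
move=> /(_ 3%N 4%N neq34 (free_res M) [:: (z, u)]) [].
- move=> p; rewrite inE => /eqP ->; exists 4%N, 0%N; split=> //; last by left.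
  exact: (@cover_compU _ _ (K 3) (4%N, _) 0 1 (sga_comp1 R)).
- by rewrite /tens_cycle /tens_d big_seq1; have := tens_w_u; rewrite -{1}map_z.
move=> t [_ /esym Et].
pose h (x : free_cover (K 3)) (y : residue R) := theta x * aug (residue_repr y).
have aug_repr r : aug (residue_repr (residue_pi r)) = aug r.
  apply: subr0_eq; rewrite -raddfB; apply: aug_max; apply/residue_pi_eq0.
  by rewrite raddfB /= residue_reprK subrr.
have hDl x x' y : h (x + x') y = h x y + h x' y by rewrite /h raddfD mulrDl.
have hDr x y y' : h x (y + y') = h x y + h x y'.
  rewrite /h -[y]residue_reprK -[y']residue_reprK -raddfD !aug_repr raddfD.
  by rewrite mulrDr.
have hZ (a : R) x y : h (a *: x) y = h x (a *: y).
  rewrite /h thetaZ -[y]residue_reprK -residue_piZ !aug_repr augM.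
  by rewrite mulrCA mulrA.
have := @tens_balanced_eq R (free_cover (K 3)) (residue R) k h hDl hDr hZ _ _
  [:: (z, u)] t id (fun p => (cover_map (K 4) p.1, p.2)) (esym Et).
rewrite big_seq1 big1 => [|p _].
  apply/eqP; rewrite /h mulf_neq0 ?theta_z //= aug_repr.
  by rewrite -(rmorph1 pi) aug_pi rmorph1 oner_neq0.
rewrite /h theta_boundary ?mul0r //.
by apply/(cover_map_image (M := K 4)); exists p.1.
Qed.

End Obstruction.

(** * Jets at the origin *)

Section Jets.
Variables (m : nat) (K : comNzRingType).
Local Notation S := {mpoly K[m]}.
Implicit Types (p q : S) (u v w : 'I_m).

Definition jet0 p : K := p.@[fun=> 0].
Definition jet1 u p := jet0 p^`M(u).
Definition jet2 u v p := jet0 p^`M(v)^`M(u).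
Definition jet3 u v w p := jet0 p^`M(w)^`M(v)^`M(u).

Lemma jet0M p q : jet0 (p * q) = jet0 p * jet0 q.
Proof. exact: mevalM. Qed.

Lemma jet1M u p q : jet1 u (p * q) = jet1 u p * jet0 q + jet0 p * jet1 u q.
Proof. by rewrite /jet1 mderivM /jet0 mevalD !mevalM. Qed.

Lemma jet2M u v p q : jet2 u v (p * q) =
  jet2 u v p * jet0 q + jet1 v p * jet1 u q + jet1 u p * jet1 v q +
  jet0 p * jet2 u v q.
Proof.
by rewrite /jet2 /jet1 !(mderivM, mderivD) /jet0 !mevalD !mevalM addrA.
Qed.

Lemma jet3M u v w p q : jet3 u v w (p * q) =
  jet3 u v w p * jet0 q + jet2 v w p * jet1 u q + jet2 u w p * jet1 v q +
  jet1 w p * jet2 u v q + jet2 u v p * jet1 w q + jet1 v p * jet2 u w q +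
  jet1 u p * jet2 v w q + jet0 p * jet3 u v w q.
Proof.
by rewrite /jet3 /jet2 /jet1 !(mderivM, mderivD) /jet0 !mevalD !mevalM; ring.
Qed.

Lemma jet0D p q : jet0 (p + q) = jet0 p + jet0 q.
Proof. exact: mevalD. Qed.

Lemma jet1D u p q : jet1 u (p + q) = jet1 u p + jet1 u q.
Proof. by rewrite /jet1 mderivD jet0D. Qed.

Lemma jet2D u v p q : jet2 u v (p + q) = jet2 u v p + jet2 u v q.
Proof. by rewrite /jet2 !mderivD jet0D. Qed.

Lemma jet0B p q : jet0 (p - q) = jet0 p - jet0 q.
Proof. exact: mevalB. Qed.

Lemma jet1B u p q : jet1 u (p - q) = jet1 u p - jet1 u q.
Proof. by rewrite /jet1 mderivB jet0B. Qed.

Lemma jet2B u v p q : jet2 u v (p - q) = jet2 u v p - jet2 u v q.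
Proof. by rewrite /jet2 !mderivB jet0B. Qed.

Lemma jet3B u v w p q : jet3 u v w (p - q) = jet3 u v w p - jet3 u v w q.
Proof. by rewrite /jet3 !mderivB jet0B. Qed.

Lemma mderivXU u v : ('X_v : S)^`M(u) = (v == u)%:R.
Proof.
rewrite mderivX mnm1E; case: eqP => [->|_]; last by rewrite scale0r.
by rewrite -{1}[U_(u)%MM]add0m addmK mpolyX0 scale1r.
Qed.

Lemma jet0X v : jet0 'X_v = 0.
Proof. exact: mevalXU. Qed.

Lemma jet1X u v : jet1 u 'X_v = (v == u)%:R.
Proof. by rewrite /jet1 mderivXU /jet0 rmorph_nat. Qed.

Lemma jet2X u v w : jet2 u v 'X_w = 0.
Proof. by rewrite /jet2 mderivXU -mpolyC_nat mderivC /jet0 meval0. Qed.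

Lemma jet0_homog d p :
  p \is d.+1.-homog -> jet0 p = 0.
Proof.
move=> /dhomogP hp; rewrite /jet0 mevalE big_seq big1 // => c /hp dc.
case: (pickP (fun i => c i != 0%N)) => [i ci|c0].
  by rewrite (bigD1 i) //= expr0n (negPf ci) mul0r mulr0.
by move: dc; rewrite /= mdegE big1 // => i _; apply/eqP/negbFE/c0.
Qed.

End Jets.

(** * The pairing of the algebra Z *)

Section Pairing.
Variables (k : fieldType) (n : nat) (i0 : 'I_n).
Local Notation S := {mpoly k[n + n + (n + n)]}.
Local Notation x1 := (lshift (n + n) (lshift n i0)).
Local Notation x2 := (lshift (n + n) (rshift n i0)).
Local Notation y1 := (rshift (n + n) (lshift n i0)).
Local Notation y2 := (rshift (n + n) (rshift n i0)).

(** Up to the factor 2, which avoids dividing derivatives by 2, this is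
    - a_1 [p2^2 q2] y + a_2 [p1^2 q1] y + a_12 [p1 q1] y, where a_1, a_2, a_12 are
    the coefficients of p1, p2, p1 p2 in a. For y = h1 g1 + ... in the ideal, the
    three coefficients of y are, up to sign, those of p2, p1 and 1 in h1; so this
    is the part of the coefficient of p1 p2 in a h1 in which a contributes a
    monomial other than 1. *)
Definition pairing (a y : S) : k :=
  jet1 x2 a * jet3 x1 x1 y1 y - jet1 x1 a * jet3 x2 x2 y2 y
  + 2%:R * jet2 x1 x2 a * jet2 x1 y1 y.

Let jetE := (jet1X, jet2X, jet0X, eq_lshift, eq_rshift, eq_lrshift,
  eq_rlshift, mulr0, mul0r, addr0, add0r, subrr, oppr0).

Lemma Zrel_jet (g : S) : Zrel g ->
  [/\ jet0 g = 0, forall u, jet1 u g = 0,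
      forall i j : 'I_(n + n), jet2 (lshift (n + n) i) (lshift (n + n) j) g = 0
    & jet2 x2 y2 g = - jet2 x1 y1 g].
Proof.
pose rules := (jet0B, jet1B, jet2B, jet0D, jet1D, jet2D, jet0M, jet1M, jet2M).
case=> [i j|i|i|i j lt|i j lt]; rewrite /p1 /p2 /q1 /q2;
  (split=> [|u|i' j'|]; rewrite ?rules ?jetE //).
all: by ring.
Qed.

Lemma Zideal_jet (y : S) : ideal_gen (@Zrel k n) y ->
  [/\ jet0 y = 0, forall u, jet1 u y = 0,
      forall i j : 'I_(n + n), jet2 (lshift (n + n) i) (lshift (n + n) j) y = 0
    & jet2 x2 y2 y = - jet2 x1 y1 y].
Proof.
elim=> [|a g x /Zrel_jet[g0 g1 g2 g3] _ [e0 e1 e2 e3]].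
  by split=> *; rewrite /jet2 /jet1 ?raddf0 /jet0 ?meval0 ?oppr0.
split=> [|u|i j|]; rewrite ?(jet0D, jet1D, jet2D).
- by rewrite jet0M g0 e0; ring.
- by rewrite jet1M g0 g1 e1; ring.
- by rewrite jet2M g0 !g1 g2 e2; ring.
by rewrite !jet2M g0 !g1 g3 e3; ring.
Qed.

Lemma pairingBl y : zmod_morphism (pairing^~ y).
Proof. by move=> a b; rewrite /pairing !jet1B jet2B; ring. Qed.

Lemma pairingBr a : zmod_morphism (pairing a).
Proof. by move=> y z; rewrite /pairing !jet3B jet2B; ring. Qed.

Lemma pairing_ideal (i y : S) :
  ideal_gen (@Zrel k n) i -> pairing i y = 0.
Proof.
by move=> /Zideal_jet[_ i1 i2 _]; rewrite /pairing !i1 i2; ring.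
Qed.

(** For y in the ideal, the Leibniz rule leaves only the terms in which at least
    two of the derivatives fall on y; they match because the coefficients of
    p1 q1 and of p2 q2 in y are opposite. *)
Lemma pairingM (a b y : S) : ideal_gen (@Zrel k n) y ->
  pairing (a * b) y = jet0 a * pairing b y + pairing a (b * y).
Proof.
move=> /Zideal_jet[y0 y1 y2 y3].
by rewrite /pairing !jet1M !jet2M !jet3M y0 !y1 !y2 y3; ring.
Qed.

End Pairing.

(** * Failure of the Koszul property *)

Theorem proposition6p4 (n : nat) (k : fieldType) :
  (1 <= n)%N -> 2 \notin [pchar k]%R -> ~ Koszul (Zalg k n).
Proof.
move=> n0 k2; pose jetE := (jet0M, jet1M, jet2M, jet0B, jet1B, jet2B, jet0X,
  jet1X, jet2X, eq_lshift, eq_rshift, eq_lrshift, eq_rlshift, eqxx).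
pose i0 : 'I_n := Ordinal n0.
have /choice [sigma sigmaP] := @Zpi_surj k n.
have sigmaK : cancel sigma (@Zpi k n) by move=> r; rewrite -sigmaP.
have jet0_I s : @Zpi k n s = 0 -> jet0 s = 0 by move=> /Zpi_eq0/(Zideal_jet i0)[].
have eps_max (s : {mpoly k[n + n + (n + n)]}) :
    @in_max_ideal k (Zalg k n) (Zpi s) -> jet0 s = 0.
  move Er : (Zpi s) => r mr; elim: mr s Er => [s|a g x [d [p [hp ->]]] _ IH s Es].
    exact: jet0_I.
  have [b Eb] := Zpi_surj a; have [c Ec] := Zpi_surj x.
  have /jet0_I : Zpi (s - (b * p + c)) = 0.
    by rewrite raddfB /= Es raddfD /= rmorphM Eb Ec subrr.
  rewrite jet0B jet0D jet0M (IH c) // addr0 => /subr0_eq ->.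
  suff -> : jet0 p = 0 by rewrite mulr0.
  exact: jet0_homog hp.
have Zrel_Zpi0 g : @Zrel k n g -> Zpi g = 0.
  move=> Gg; apply/Zpi_eq0; rewrite -[g]mul1r -[1 * g]addr0.
  by apply: ideal_genD Gg _; apply: ideal_gen0.
have degX (i : 'I_(n + n + (n + n))) : @sga_comp k (Zalg k n) 1 (Zpi 'X_i).
  by exists 'X_i; rewrite dhomogX /= mdeg1.
apply: (@obstruction_not_Koszul k (Zalg k n) _ (@Zpi k n) _ sigma sigmaK eps_max
  (pairing i0) _ _ _ _ (p1 k i0) (p2 k i0) (q1 k i0) (q2 k i0)).
- exact: pairingBl.
- exact: pairingBr.
- by move=> i y /Zpi_eq0; apply: pairing_ideal.
- by move=> a b y /Zpi_eq0; apply: pairingM.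
- exact: degX.
- exact: degX.
- exact: degX.
- exact: degX.
- exact/Zrel_Zpi0/Zrel_pq.
- exact/Zrel_Zpi0/Zrel_12.
- exact/Zrel_Zpi0/Zrel_21.
- by move=> y; rewrite /pairing /p1 !jetE /=; ring.
- by move=> y; rewrite /pairing /p2 !jetE /=; ring.
- move=> x y /Zpi_eq0/(Zideal_jet i0)[y0 y1 _ _].
  rewrite /pairing /p1 /p2 !jetE /= y0 !y1.
  by rewrite -/(jet0 x); ring.
rewrite /pairing /p1 /p2 /q1 /q2 !jetE /=.
rewrite [X in X != 0](_ : _ = 2%:R); last by ring.
by apply: contra k2; rewrite inE.
Qed.
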